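(* Consider FedAvg with partial device participation under Scheme I (sampling $K$ devices with replacement according to $p_1,\dots,p_N$, simple averaging), $1\le K\le N$, with $E\ge 1$ local steps per round and run for $T\ge 1$ steps with $E\mid T$, applied to $F=\sum_{k=1}^N p_kF_k$. Assume: (1) each $F_k$ is $L$-smooth: $F_k(\mathbf v)\le F_k(\mathbf w)+(\mathbf v-\mathbf w)^\top\nabla F_k(\mathbf w)+\frac L2\|\mathbf v-\mathbf w\|_2^2$ for all $\mathbf v,\mathbf w$; (2) each $F_k$ is $\mu$-strongly convex, $\mu>0$: $F_k(\mathbf v)\ge F_k(\mathbf w)+(\mathbf v-\mathbf w)^\top\nabla F_k(\mathbf w)+\frac \mu2\|\mathbf v-\mathbf w\|_2^2$ for all $\mathbf v,\mathbf w$; (3) $\mathbb E\|\nabla F_k(\mathbf w_t^k,\xi_t^k)-\nabla F_k(\mathbf w_t^k)\|^2\le\sigma_k^2$ for all $k=1,\dots,N$ and $t=0,\dots,T-1$; (4) $\mathbb E\|\nabla F_k(\mathbf w_t^k,\xi_t^k)\|^2\le G^2$ for all $k=1,\dots,N$ and $t=0,\dots,T-1$. Let $\kappa=\frac L\mu$, $\gamma=\max\{8\kappa,E\}$, $\eta_t=\frac{2}{\mu(\gamma+t)}$, $B=\sum_{k=1}^N p_k^2\sigma_k^2+6L\Gamma+8(E-1)^2G^2$ and $C=\frac4KE^2G^2$. Then $$\mathbb E[F(\mathbf w_T)]-F^*\le\frac{\kappa}{\gamma+T-1}\left(\frac{2(B+C)}{\mu}+\frac{\mu\gamma}{2}\,\mathbb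 E\|\mathbf w_1-\mathbf w^*\|^2\right).$$
   Context: Problem: $N$ devices with weights $p_k\ge0$, $\sum_{k=1}^Np_k=1$. Device $k$ holds data $x_{k,1},\dots,x_{k,n_k}$ and has the differentiable local objective $F_k(\mathbf w)=\frac1{n_k}\sum_{j=1}^{n_k}\ell(\mathbf w;x_{k,j})$ on $\mathbb R^d$, where $\ell$ is a loss function differentiable in $\mathbf w$. For a data point $\xi$ of device $k$, $\nabla F_k(\mathbf w,\xi)$ denotes the stochastic gradient $\nabla_{\mathbf w}\ell(\mathbf w;\xi)$. The global objective is $F=\sum_kp_kF_k$; $\mathbf w^*$ is its minimizer, $F^*=F(\mathbf w^* )$, $F_k^*=\min F_k$, and $\Gamma=F^*-\sum_{k=1}^Np_kF_k^*$. FedAvg with partial participation, Scheme I: start from a fixed $\mathbf w_0$, $\mathbf w_0^k=\mathbf w_0$ for all $k$. Let $\mathcal I_E=\{nE: n=1,2,\dots\}$. For $t=0,1,\dots$ and every $k\in\{1,\dots,N\}$, $$\mathbf v_{t+1}^k=\mathbf w_t^k-\eta_t\nabla F_k(\mathbf w_t^k,\xi_t^k),$$ where $\xi_t^k$ is drawn uniformly at random from device $k$'s data, independently across devices and steps. If $t+1\notin\mathcal I_E$, $\mathbf w_{t+1}^k=\mathbf v_{t+1}^k$. If $t+1\in\mathcal I_E$, the server draws a multiset $\mathcal S_{t+1}=\{i_1,\dots,i_K\}$ of $K$ indices, i.i.d. with replacement from $\{1,\dots,N\}$ with probabilities $p_1,\dots,p_N$, independently of everything else, and sets $\mathbf w_{t+1}^k=\frac1K\sum_{l=1}^K\mathbf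 v_{t+1}^{i_l}$ for all $k$. (Updating all devices locally and using only the sampled ones is equivalent to updating only the sampled ones.) For every $t$, $\mathbf w_t$ denotes the average $\sum_{k=1}^Np_k\mathbf w_t^k$ (which equals the common value of all $\mathbf w_t^k$ when $t\in\mathcal I_E$). $\|\cdot\|$ is the Euclidean norm. *)

(* Defs.v *)
From HB Require Import structures.
From mathcomp Require Import all_boot all_order all_algebra.
From mathcomp Require Import all_classical all_reals all_analysis.

Set Implicit Arguments.
Unset Strict Implicit.
Unset Printing Implicit Defensive.

Import Order.TTheory GRing.Theory Num.Theory.
Import numFieldNormedType.Exports.

Local Open Scope classical_set_scope.
Local Open Scope ring_scope.

Section Euclidean.
Context {R : realType} {d : nat}.
Implicit Types (u v w : 'rV[R]_d) (f : 'rV[R]_d -> R).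

Definition dotv u v : R := \sum_(i < d) u 0 i * v 0 i.

(* The library norm [`|u|] on matrices is the sup norm, hence this definition. *)
Definition enorm u : R := Num.sqrt (dotv u u).

Definition grad f w : 'rV[R]_d := \row_(i < d) 'D_(delta_mx 0 i) f w.

Definition smooth_fun (L : R) f := forall v w,
  f v <= f w + dotv (v - w) (grad f w) + L / 2 * enorm (v - w) ^+ 2.

Definition strongly_convex_fun (mu : R) f := forall v w,
  f w + dotv (v - w) (grad f w) + mu / 2 * enorm (v - w) ^+ 2 <= f v.

Definition is_minimizer f w := forall v, f w <= f v.

Definition is_min_value f (m : R) := exists2 w, is_minimizer f w & f w = m.

End Euclidean.

Section DiscreteProbability.
Context {disp : measure_display} {Omega : measurableType disp} {R : realType}.
Variable P : probability Omega R.

(* A random variable with values in a finite set: its point preimages are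
   events, and [q] is its probability mass function. *)
Definition has_pmf (V : finType) (Y : Omega -> V) (q : V -> R) :=
  forall a, measurable (Y @^-1` [set a]) /\ P (Y @^-1` [set a]) = (q a)%:E.

(* Mutual independence of the finite-valued family [Y i], [i] in [D]. All
   subsets of a finite set are measurable, so the [A i] are unrestricted. *)
Definition mutually_independent (I : eqType) (V : I -> finType)
    (D : set I) (Y : forall i, Omega -> V i) :=
  forall (s : seq I) (A : forall i, set (V i)),
    uniq s -> (forall i, i \in s -> D i) ->
    fine (P (\bigcap_(i in [set` s]) (Y i @^-1` A i))) =
    \prod_(i <- s) fine (P (Y i @^-1` A i)).

End DiscreteProbability.

Section FederatedAveraging.
Context {R : realType} {d N : nat} {X : Type} {n : 'I_N -> nat}.
Variables (ell : 'rV[R]_d -> X -> R) (x : forall k, 'I_(n k) -> X).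

Definition stoch_grad (w : 'rV[R]_d) (xi : X) : 'rV[R]_d := grad (ell ^~ xi) w.

Definition local_objective (k : 'I_N) (w : 'rV[R]_d) : R :=
  (n k)%:R^-1 * \sum_(j < n k) ell w (x j).

Definition global_objective (p : 'I_N -> R) (w : 'rV[R]_d) : R :=
  \sum_(k < N) p k * local_objective k w.

Definition sync_time (E t : nat) : bool := (0 < t)%N && (E %| t)%N.

(* The sample path of the local iterates w_t^k driven by the realized draws:
   [j t k] is the position, in the data of device [k], of the data point drawn
   at step [t], and [s t] lists the [K] devices drawn at a time [t] of
   synchronization ([s t] is not used at the other times). *)
Fixpoint fedavg (K E : nat) (eta : nat -> R) (w0 : 'rV[R]_d)
    (j : nat -> forall k : 'I_N, 'I_(n k)) (s : nat -> 'I_K -> 'I_N)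
    (t : nat) (k : 'I_N) : 'rV[R]_d :=
  match t with
  | 0%N => w0
  | t'.+1 =>
      let w := fedavg E eta w0 j s t' in
      let v i := w i - eta t' *: stoch_grad (w i) (x (j t' i)) in
      if sync_time E t'.+1
      then K%:R^-1 *: \sum_(l < K) v (s t'.+1 l)
      else v k
  end.

Section Draws.
Context {K : nat} {Omega : Type}.
Variables (xi : nat -> forall k : 'I_N, Omega -> 'I_(n k))
          (S : nat -> 'I_K -> Omega -> 'I_N).

(* The elementary draws, gathered into a single family so that their joint
   independence can be stated: [inl (t, k)] is the data draw of device [k] at
   step [t], and [inr (t, l)] is the [l]-th device draw at time [t]. *)
Definition draw_index : Type := (nat * 'I_N + nat * 'I_K)%type.

Definition draw_type (i : draw_index) : finType :=
  match i with inl u => 'I_(n u.2) | inr _ => 'I_N end.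

Definition draw (i : draw_index) : Omega -> draw_type i :=
  match i with inl u => xi u.1 u.2 | inr u => S u.1 u.2 end.

Definition performed_draws (E : nat) : set draw_index :=
  [set i | match i with inl _ => True | inr u => sync_time E u.1 end].

End Draws.

End FederatedAveraging.

(* Main.v *)
(* Let Delta_t = E |w_t - w*|^2.  Smoothness and strong convexity of the F_k give
   a pathwise bound for the mean of the exact local gradient steps:
     |mean step - w*|^2 <= (1 - mu eta) |w_t - w*|^2
                           + 2 sum_k p_k |w_t^k - w_t|^2 + 6 L eta^2 Gamma.
   The gradient noises and the deviations of the sampled devices from the mean are
   each centered with respect to their own draw, so all cross terms vanish in
   expectation and only variances remain.  Within a round the step sizes vary by a
   factor at most 2, so the drift and the sampling variance are of order
   eta_t^2 E^2 G^2.  This gives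
     Delta_(t+1) <= (1 - mu eta_t) Delta_t + eta_t^2 (B + C),
   and induction yields Delta_t <= v / (gamma + t - 1) for t >= 1, where
   v = 4 (B + C) / mu^2 + gamma Delta_1.

   No filtration is needed: an iterate is a function of the family z of all draws,
   and the expectation of a function depending on finitely many draws is the
   iterated weighted average over these coordinates.  Averaging over one more of
   these coordinates leaves it unchanged, which plays the role of conditioning. *)

Require Import Defs.
From HB Require Import structures.
From mathcomp Require Import all_boot all_order all_algebra.
From mathcomp Require Import all_classical all_reals all_analysis.
From mathcomp Require Import ring lra.

Set Implicit Arguments.
Unset Strict Implicit.
Unset Printing Implicit Defensive.

Import Order.TTheory GRing.Theory Num.Theory.
Import numFieldNormedType.Exports.

Local Open Scope classical_set_scope.
Local Open Scope ring_scope.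

Local Notation sqnorm u := (dotv u u).

(** * Inner product, weighted means and the bias-variance identity *)

Section DotProduct.
Context {R : realType} {d : nat}.
Implicit Types (u v w c : 'rV[R]_d).

Lemma dotvC u v : dotv u v = dotv v u.
Proof. by apply: eq_bigr => i _; rewrite mulrC. Qed.

Lemma dotvDl u v w : dotv (u + v) w = dotv u w + dotv v w.
Proof. by rewrite -big_split; apply: eq_bigr => i _; rewrite mxE mulrDl. Qed.

Lemma dotvZl a u v : dotv (a *: u) v = a * dotv u v.
Proof. by rewrite mulr_sumr; apply: eq_bigr => i _; rewrite mxE mulrA. Qed.

Lemma dotvNl u v : dotv (- u) v = - dotv u v.
Proof. by rewrite -scaleN1r dotvZl mulN1r. Qed.

Lemma dotvDr u v w : dotv w (u + v) = dotv w u + dotv w v.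
Proof. by rewrite dotvC dotvDl !(dotvC w). Qed.

Lemma dotvZr a u v : dotv v (a *: u) = a * dotv v u.
Proof. by rewrite dotvC dotvZl dotvC. Qed.

Lemma dotvNr u v : dotv v (- u) = - dotv v u.
Proof. by rewrite dotvC dotvNl dotvC. Qed.

Lemma dotv0l v : dotv 0 v = 0.
Proof. by rewrite -(scale0r 0) dotvZl mul0r. Qed.

Lemma dotv_suml I (s : seq I) (u : I -> 'rV[R]_d) v :
  dotv (\sum_(i <- s) u i) v = \sum_(i <- s) dotv (u i) v.
Proof. by apply: (big_morph (dotv^~ v)) => [? ?|]; rewrite ?dotvDl ?dotv0l. Qed.

Lemma dotv_sumr I (s : seq I) (u : I -> 'rV[R]_d) v :
  dotv v (\sum_(i <- s) u i) = \sum_(i <- s) dotv v (u i).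
Proof. by rewrite dotvC dotv_suml; apply: eq_bigr => i _; rewrite dotvC. Qed.

Definition dotvE := (dotvDl, dotvDr, dotvNl, dotvNr, dotvZl, dotvZr).

Lemma sqnorm_ge0 u : 0 <= sqnorm u.
Proof. by apply: sumr_ge0 => i _; rewrite -expr2 sqr_ge0. Qed.

Lemma sqnorm_eq0 u : sqnorm u = 0 -> u = 0.
Proof.
move/psumr_eq0P => u0; apply/rowP => i; apply/eqP.
by rewrite mxE -sqrf_eq0 expr2 u0// => j _; rewrite -expr2 sqr_ge0.
Qed.

Lemma enorm_sqr u : enorm u ^+ 2 = sqnorm u.
Proof. by rewrite sqr_sqrtr// sqnorm_ge0. Qed.

Lemma sqnormN u : sqnorm (- u) = sqnorm u.
Proof. by rewrite dotvNl dotvNr opprK. Qed.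

Lemma sqnorm_delta (i : 'I_d) : sqnorm (delta_mx 0 i : 'rV[R]_d) = 1.
Proof.
rewrite /dotv (bigD1 i)//= mxE !eqxx mulr1 big1 ?addr0// => j /negPf ji.
by rewrite mxE ji andbF mul0r.
Qed.

(** Bias-variance identity. Once |m - c|^2 is written as a [p]-weighted sum, it holds term by term:
    |u - c|^2 = 2 <u, m - c> - <m + c, m - c> + |u - m|^2. *)
Lemma sqnorm_weighted_sum N (p : 'I_N -> R) (u : 'I_N -> 'rV[R]_d) c :
  \sum_(k < N) p k = 1 ->
  let m := \sum_(k < N) p k *: u k in
  \sum_(k < N) p k * sqnorm (u k - c) =
  sqnorm (m - c) + \sum_(k < N) p k * sqnorm (u k - m).
Proof.
move=> p1 m.
have -> : sqnorm (m - c) = \sum_k p k * (2 * dotv (u k) (m - c)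
    - dotv (m + c) (m - c)).
  under eq_bigr do rewrite mulrBr mulrCA; rewrite big_split/= sumrN -mulr_suml p1.
  have -> : \sum_k 2 * (p k * dotv (u k) (m - c)) = 2 * dotv m (m - c).
    rewrite -mulr_sumr /m dotv_suml; congr (_ * _).
    by apply: eq_bigr => k _; rewrite dotvZl.
  by rewrite !dotvE (dotvC c m); ring.
rewrite -big_split; apply: eq_bigr => k _ /=.
by rewrite !dotvE (dotvC c m) (dotvC c (u k)) (dotvC m (u k)); ring.
Qed.

Lemma sqnorm_mean_le N (p : 'I_N -> R) (u : 'I_N -> 'rV[R]_d) c :
  (forall k, 0 <= p k) -> \sum_(k < N) p k = 1 ->
  sqnorm (\sum_(k < N) p k *: u k - c) <= \sum_(k < N) p k * sqnorm (u k - c).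
Proof.
move=> p0 p1; rewrite sqnorm_weighted_sum// lerDl sumr_ge0// => k _.
by rewrite mulr_ge0// sqnorm_ge0.
Qed.

Lemma sqnorm_sub_mean_le N (p : 'I_N -> R) (u : 'I_N -> 'rV[R]_d) c :
  (forall k, 0 <= p k) -> \sum_(k < N) p k = 1 ->
  \sum_(k < N) p k * sqnorm (u k - \sum_(k < N) p k *: u k) <=
  \sum_(k < N) p k * sqnorm (u k - c).
Proof. by move=> p0 p1; rewrite (sqnorm_weighted_sum u c p1) lerDr sqnorm_ge0. Qed.

(** Both sides are double sums over pairs, compared through <u_i, u_j> <= (|u_i|^2 + |u_j|^2) /
    2. *)
Lemma sqnorm_sum_le m (u : 'I_m -> 'rV[R]_d) :
  sqnorm (\sum_(i < m) u i) <= m%:R * \sum_(i < m) sqnorm (u i).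
Proof.
rewrite dotv_suml; under eq_bigr do rewrite dotv_sumr.
have -> : m%:R * \sum_(i < m) sqnorm (u i) =
    \sum_(i < m) \sum_(j < m) 2^-1 * (sqnorm (u i) + sqnorm (u j)).
  set s := \sum_(i < m) sqnorm (u i).
  under eq_bigr do rewrite -mulr_sumr big_split/= sumr_const card_ord -mulr_natl -/s.
  rewrite -mulr_sumr big_split/= sumr_const card_ord sumrMnl -/s -!(mulr_natl s).
  by field.
apply: ler_sum => i _; apply: ler_sum => j _.
have := sqnorm_ge0 (u i - u j).
by rewrite !dotvE (dotvC (u j) (u i)); lra.
Qed.

End DotProduct.

(** * Deterministic descent for smooth, strongly convex functions *)

Section SmoothConvex.
Context {R : realType} {d : nat}.
Variables (L mu : R).
Implicit Types (f : 'rV[R]_d -> R) (v w : 'rV[R]_d).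

(** Between 0 and a unit vector, which exists as [0 < d], the two quadratic bounds differ only in
    [mu / 2] and [L / 2]. *)
Lemma smooth_strongly_convex_le f : (0 < d)%N ->
  smooth_fun L f -> strongly_convex_fun mu f -> mu <= L.
Proof.
move=> d0 fL fmu; pose e : 'rV[R]_d := delta_mx 0 (Ordinal d0).
have := fL e 0; have := fmu e 0.
by rewrite subr0 enorm_sqr sqnorm_delta; lra.
Qed.

Hypothesis L0 : 0 < L.

(* The descent step from [w] of length [1 / L] decreases [f] by at least
   [|grad f w|^2 / (2 L)]. *)
Lemma sqnorm_grad_le f m w : smooth_fun L f -> (forall v, m <= f v) ->
  sqnorm (grad f w) <= 2 * L * (f w - m).
Proof.
move=> fL fm; set g := grad f w.
have := le_trans (fm _) (fL (w - L^-1 *: g) w).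
rewrite (addrAC w) subrr add0r enorm_sqr -/g !dotvE.
have : L * (L^-1 * (L^-1 * sqnorm g)) = L^-1 * sqnorm g by rewrite mulVKf ?gt_eqF.
move=> E H; have : L^-1 * sqnorm g / 2 <= f w - m by lra.
rewrite ler_pdivrMr// ler_pdivrMl//; lra.
Qed.

(** Young's inequality for <c - u, grad f u>, convexity from [u] to [v] and the bound on |grad f
    u|^2 leave the term -2 eta (1 - 2 eta L) (f u - m). Then [f u] is exchanged for [f c], at the
    price of a second |c - u|^2: in the application [c] is common to all devices, so minimality of
    the global objective can be used there. *)
Lemma local_descent f m eta u c v : 0 < eta -> 4 * (eta * L) <= 1 -> 0 <= mu ->
  smooth_fun L f -> strongly_convex_fun mu f -> (forall w, m <= f w) ->
  - (2 * eta * dotv (c - v) (grad f u)) + eta ^+ 2 * sqnorm (grad f u) <=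
  2 * sqnorm (c - u) - 2 * eta * (1 - 2 * (eta * L)) * (1 - eta * L) * (f c - m)
  + 2 * eta * (f v - m) - eta * mu * sqnorm (u - v).
Proof.
move=> eta0 etaL mu0 fL fmu fm.
have young (a b : 'rV[R]_d) : - (2 * eta * dotv a b) <= sqnorm a + eta ^+ 2 * sqnorm b.
  by have := sqnorm_ge0 (a + eta *: b); rewrite !dotvE (dotvC b a); nra.
have gu := sqnorm_grad_le u fL fm.
have gc := sqnorm_grad_le c fL fm.
have yu := young (c - u) (grad f u).
have yc := young (u - c) (grad f c).
have su := fmu v u; have sc := fmu u c.
rewrite !enorm_sqr -(sqnormN (v - u)) opprB in su.
rewrite enorm_sqr in sc.
have dc : sqnorm (c - u) = sqnorm (u - c) by rewrite -sqnormN opprB.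
have D0 := sqnorm_ge0 (u - c).
have -> : dotv (c - v) (grad f u) = dotv (c - u) (grad f u) - dotv (v - u) (grad f u).
  by rewrite !dotvE; ring.
rewrite dc in yu *.
move: gu gc yu yc su sc D0.
move: (sqnorm (grad f u)) (sqnorm (grad f c)) (dotv (c - u) _) (dotv (v - u) _)
  (dotv (u - c) _) (sqnorm (u - c)) (sqnorm (u - v)) (f u) (f v) (f c).
move=> gu gc a b a' D D' fu fv fc Hgu Hgc yu yc su sc D0.
have e2 : 0 <= eta ^+ 2 by rewrite exprn_ge0// ltW.
have H1 : eta ^+ 2 * gu <= eta ^+ 2 * (2 * L * (fu - m)) by rewrite ler_wpM2l.
have H2 : eta ^+ 2 * gc <= eta ^+ 2 * (2 * L * (fc - m)) by rewrite ler_wpM2l.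
have muD : 0 <= mu / 2 * D by rewrite mulr_ge0// divr_ge0.
have H3 : 2 * eta * (fc + a') <= 2 * eta * fu.
  by rewrite ler_pM2l; lra.
have H4 : 2 * eta * (b + mu / 2 * D') <= 2 * eta * (fv - fu).
  by rewrite ler_pM2l; lra.
(* Convexity at [c] and Young's inequality bound [f u - m] from below; the weight 1 - 2 eta L is
   nonnegative by the bound on [eta]. *)
have H5 : (1 - 2 * (eta * L)) * (2 * eta * (fc - m) * (1 - eta * L) - D)
   <= (1 - 2 * (eta * L)) * (2 * eta * (fu - m)).
  by apply: ler_wpM2l; lra.
have H6 : 0 <= eta * L * D by rewrite mulr_ge0// mulr_ge0// ltW.
lra.
Qed.

Lemma mean_descent N (p : 'I_N -> R) (f : 'I_N -> 'rV[R]_d -> R) (m : 'I_N -> R)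
    (eta : R) (u : 'I_N -> 'rV[R]_d) v :
  (forall k, 0 <= p k) -> \sum_(k < N) p k = 1 ->
  0 < eta -> 4 * (eta * L) <= 1 -> 0 <= mu ->
  (forall k, smooth_fun L (f k)) -> (forall k, strongly_convex_fun mu (f k)) ->
  (forall k w, m k <= f k w) ->
  is_minimizer (fun w => \sum_(k < N) p k * f k w) v ->
  forall c, c = \sum_(k < N) p k *: u k ->
  sqnorm (c - v - eta *: \sum_(k < N) p k *: grad (f k) (u k)) <=
  (1 - mu * eta) * sqnorm (c - v) + 2 * \sum_(k < N) p k * sqnorm (u k - c)
  + eta ^+ 2 * (6 * L * (\sum_(k < N) p k * f k v - \sum_(k < N) p k * m k)).
Proof.
move=> p0 p1 eta0 etaL mu0 fL fmu fm vmin _ ->.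
set c := \sum_(k < N) p k *: u k.
set g := \sum_(k < N) _ *: grad _ _.
have step : - (2 * eta * dotv (c - v) g) + eta ^+ 2 * sqnorm g <=
   \sum_(k < N) p k * (- (2 * eta * dotv (c - v) (grad (f k) (u k)))
                 + eta ^+ 2 * sqnorm (grad (f k) (u k))).
  have := sqnorm_mean_le (fun k => grad (f k) (u k)) 0 p0 p1.
  rewrite subr0 -/g; under eq_bigr do rewrite subr0.
  move=> Hg; under eq_bigr do rewrite mulrDr mulrN mulrCA (mulrCA (p _)).
  rewrite big_split/= sumrN -!mulr_sumr; apply: lerD.
    rewrite {1}/g dotv_sumr lerN2; under eq_bigr do rewrite -dotvZr.
    exact: lexx.
  by rewrite ler_wpM2l// exprn_ge0// ltW.
have step2 : \sum_(k < N) p k * (- (2 * eta * dotv (c - v) (grad (f k) (u k)))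
      + eta ^+ 2 * sqnorm (grad (f k) (u k))) <=
    \sum_(k < N) p k * (2 * sqnorm (c - u k)
      - 2 * eta * (1 - 2 * (eta * L)) * (1 - eta * L) * (f k c - m k)
      + 2 * eta * (f k v - m k) - eta * mu * sqnorm (u k - v)).
  by apply: ler_sum => k _; rewrite ler_wpM2l//; exact: local_descent.
set D := \sum_(k < N) p k * sqnorm (u k - c).
set D' := \sum_(k < N) p k * sqnorm (u k - v).
set a := \sum_(k < N) p k * (f k c - m k).
set b := \sum_(k < N) p k * (f k v - m k).
have jensen : sqnorm (c - v) <= D' by exact: sqnorm_mean_le.
clearbody c.
have : \sum_(k < N) p k * (2 * sqnorm (c - u k)
   - 2 * eta * (1 - 2 * (eta * L)) * (1 - eta * L) * (f k c - m k)
   + 2 * eta * (f k v - m k) - eta * mu * sqnorm (u k - v)) =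
  2 * D - 2 * eta * (1 - 2 * (eta * L)) * (1 - eta * L) * a
  + 2 * eta * b - eta * mu * D'.
  rewrite /D /D' /a /b !mulr_sumr -!sumrN -!big_split/=; apply: eq_bigr => k _.
  by rewrite -(sqnormN (c - u k)) opprB; ring.
move=> E; rewrite {}E in step2; have {step2}step := le_trans step step2.
have -> : \sum_(k < N) p k * f k v - \sum_(k < N) p k * m k = b.
  by rewrite -sumrB; apply: eq_bigr => k _; rewrite mulrBr.
have ab : b <= a.
  rewrite /a /b; under eq_bigr do rewrite mulrBr.
  under [leRHS]eq_bigr do rewrite mulrBr.
  by rewrite !sumrB lerD2r; exact: vmin.
have b0 : 0 <= b by apply: sumr_ge0 => k _; rewrite mulr_ge0// subr_ge0.
have -> : sqnorm (c - v - eta *: g) = sqnorm (c - v) - 2 * eta * dotv (c - v) g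
    + eta ^+ 2 * sqnorm g.
  by rewrite [LHS]dotvDl !dotvDr !dotvE (dotvC g c) (dotvC g v); ring.
have e0 : 0 <= eta * L by rewrite mulr_ge0 ?ltW.
move: step jensen ab b0; move: (sqnorm (c - v)) (dotv _ g) (sqnorm g) => x1 x2 x3.
clearbody D D' a b; clear - eta0 etaL mu0 e0 L0.
move=> step jensen ab b0.
have H1 : eta * mu * x1 <= eta * mu * D' by rewrite ler_wpM2l// mulr_ge0// ltW.
(* Since [b <= a], what remains is at most 2 eta b (1 - (1 - 2e)(1 - e)) = 2 eta b (3e - 2e^2) with
   e = eta L; dropping the square gives the constant 6. *)
have H2 : 2 * eta * ((1 - 2 * (eta * L)) * (1 - eta * L)) * b <=
          2 * eta * ((1 - 2 * (eta * L)) * (1 - eta * L)) * a.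
  by rewrite ler_wpM2l// !mulr_ge0//; lra.
have H3 : 0 <= eta * (eta * L) ^+ 2 * b by rewrite !mulr_ge0// ltW.
nra.
Qed.

(* The upper quadratic bound at a minimizer already forces a zero gradient there. *)
Lemma mean_smooth_upper N (p : 'I_N -> R) (f : 'I_N -> 'rV[R]_d -> R) v w :
  (forall k, 0 <= p k) -> \sum_(k < N) p k = 1 ->
  (forall k, smooth_fun L (f k)) ->
  is_minimizer (fun w => \sum_(k < N) p k * f k w) v ->
  \sum_(k < N) p k * f k w <= \sum_(k < N) p k * f k v + L / 2 * sqnorm (w - v).
Proof.
move=> p0 p1 fL vmin; set g := \sum_(k < N) p k *: grad (f k) v.
have up y : \sum_(k < N) p k * f k y <=
    \sum_(k < N) p k * f k v + dotv (y - v) g + L / 2 * sqnorm (y - v).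
  have -> : L / 2 * sqnorm (y - v) = \sum_(k < N) p k * (L / 2 * sqnorm (y - v)).
    by rewrite -mulr_suml p1 mul1r.
  rewrite dotv_sumr -!big_split/=.
  apply: ler_sum => k _; rewrite dotvZr -!mulrDr ler_wpM2l//.
  by have := fL k y v; rewrite enorm_sqr.
have H := le_trans (vmin _) (up (v - L^-1 *: g)).
rewrite (addrAC v) subrr add0r !dotvE in H.
have E : L * (L^-1 * (L^-1 * sqnorm g)) = L^-1 * sqnorm g by rewrite mulVKf ?gt_eqF.
have : L^-1 * sqnorm g <= 0 by lra.
rewrite pmulr_rle0 ?invr_gt0// => g0; have := up w.
have -> : g = 0 by apply: sqnorm_eq0; apply/eqP; rewrite eq_le g0 sqnorm_ge0.
by rewrite dotvC dotv0l addr0.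
Qed.

End SmoothConvex.

(* [mathcomp_extra] shadows [eqtype.dfwith] by a version with an explicit index. *)
Local Notation upd z a := (eqtype.dfwith z a).

(** * Expectation over finitely many coordinates as an iterated average *)

Section ProductExpectation.
Context {R : realType} {I : eqType} {V : I -> finType}.
Variable q : forall i, V i -> R.
Implicit Types (i : I) (s : seq I) (z : forall i, V i) (f g : (forall i, V i) -> R).

(** The conditional expectation given all coordinates other than [i]. *)
Definition avg i f : (forall i, V i) -> R :=
  fun z => \sum_(a : V i) q a * f (upd z a).

(** The result is still a function of the family, so a base point has to be supplied; its choice is
    immaterial when [f] depends only on [s]. *)
Definition prodE s f : (forall i, V i) -> R := foldr avg f s.

Definition depends_on (T : Type) s (f : (forall i, V i) -> T) :=
  forall z z', (forall i, i \in s -> z i = z' i) -> f z = f z'.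

Definition free_of (T : Type) i (f : (forall i, V i) -> T) :=
  forall z (a : V i), f (upd z a) = f z.

Lemma upd_id z i (a b : V i) : upd (upd z a) b = upd z b.
Proof.
apply: functional_extensionality_dep => j.
have [<-|ij] := eqVneq i j; first by rewrite !dfwith_in.
by rewrite !dfwith_out.
Qed.

Lemma updC z i j (a : V i) (b : V j) : i != j ->
  upd (upd z a) b = upd (upd z b) a.
Proof.
move=> ij; apply: functional_extensionality_dep => k.
have [<-|jk] := eqVneq j k.
  by rewrite dfwith_in dfwith_out ?dfwith_in.
rewrite (dfwith_out _ _ jk); have [<-|ik] := eqVneq i k; first by rewrite !dfwith_in.
by rewrite !dfwith_out.
Qed.

Lemma avgC i j f : avg i (avg j f) = avg j (avg i f).
Proof.
have [->//|ij] := eqVneq i j.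
apply/funext => z; rewrite /avg; under eq_bigr do rewrite mulr_sumr.
under [RHS]eq_bigr do rewrite mulr_sumr.
rewrite exchange_big/=; apply: eq_bigr => a _; apply: eq_bigr => b _.
by rewrite mulrCA updC// eq_sym.
Qed.

Lemma prodE_sum s J (r : seq J) (F : J -> (forall i, V i) -> R) :
  prodE s (fun z => \sum_(j <- r) F j z) = fun z => \sum_(j <- r) prodE s (F j) z.
Proof.
elim: s => //= i s ->; apply/funext => z.
by rewrite /avg exchange_big; apply: eq_bigr => a _; rewrite mulr_sumr.
Qed.

Lemma prodED s f g : prodE s (fun z => f z + g z) = fun z => prodE s f z + prodE s g z.
Proof.
elim: s => //= i s ->; apply/funext => z.
by rewrite /avg -big_split; apply: eq_bigr => a _; rewrite mulrDr.
Qed.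

Lemma prodEZ s c f : prodE s (fun z => c * f z) = fun z => c * prodE s f z.
Proof.
elim: s => //= i s ->; apply/funext => z.
by rewrite /avg mulr_sumr; apply: eq_bigr => a _; rewrite mulrCA.
Qed.

Lemma prodE_upd s i (a : V i) f z : i \notin s ->
  prodE s (fun z => f (upd z a)) z = prodE s f (upd z a).
Proof.
elim: s z => //= j s IH z; rewrite inE negb_or => /andP[ij /IH {}IH].
by apply: eq_bigr => b _; rewrite IH updC// eq_sym.
Qed.

Hypothesis q_ge0 : forall i (a : V i), 0 <= q a.
Hypothesis q_sum1 : forall i, \sum_(a : V i) q a = 1.

Lemma prodE_le s f g : (forall z, f z <= g z) -> forall z, prodE s f z <= prodE s g z.
Proof.
move=> fg; elim: s => //= i s IH z; apply: ler_sum => a _.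
by rewrite ler_wpM2l// q_ge0.
Qed.

Lemma avg_free i f : free_of i f -> avg i f = f.
Proof.
move=> fi; apply/funext => z; rewrite /avg.
by under eq_bigr do rewrite fi; rewrite -mulr_suml q_sum1 mul1r.
Qed.

Lemma avg_free_of i f : free_of i (avg i f).
Proof. by move=> z a; apply: eq_bigr => b _; rewrite upd_id. Qed.

Lemma prodE_cst s c : prodE s (fun=> c) = fun=> c.
Proof. by elim: s => //= i s ->; rewrite avg_free. Qed.

(** Tower property: the extra average commutes with the others until it meets the average over [i],
    whose result is already free of [i]. *)
Lemma prodE_avg s i f : i \in s -> prodE s (avg i f) = prodE s f.
Proof.
have cm t : prodE t (avg i f) = avg i (prodE t f).
  by elim: t => //= j t ->; rewrite avgC.
elim: s => //= j s IH; rewrite inE => /predU1P[<-|/IH->//].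
by rewrite cm (avg_free (@avg_free_of _ _)).
Qed.

End ProductExpectation.

(** * From the probability space to iterated averages *)

Section ExpectationOfDraws.
Context {disp : measure_display} {Omega : measurableType disp} {R : realType}.
Variable P : probability Omega R.
Context {I : eqType} {V : I -> finType}.
Variables (q : forall i, V i -> R) (D : set I) (Y : forall i, Omega -> V i).
Hypothesis pmfY : forall i, D i -> has_pmf P (@Y i) (@q i).
Hypothesis indepY : mutually_independent P D Y.

Local Definition Yz w : forall i, V i := fun i => @Y i w.

(** Integrability travels with the value because additivity of the integral requires it. *)
Local Definition has_expectation (h : Omega -> R) (r : R) :=
  P.-integrable setT (EFin \o h) /\ 'E_P[h]%E = r%:E.

Lemma has_expectation_sum J (r : seq J) (h : J -> Omega -> R) (e : J -> R) :
  (forall j, has_expectation (h j) (e j)) ->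
  has_expectation (fun w => \sum_(j <- r) h j w) (\sum_(j <- r) e j).
Proof.
move=> he; have E : EFin \o (fun w => \sum_(j <- r) h j w) =
    fun w => (\sum_(j <- r) (EFin \o h j) w)%E.
  by apply/funext => w /=; rewrite sumEFin.
split; first by rewrite E; apply: integrable_sum => // j _; exact: (he j).1.
rewrite unlock.
have -> : (\int[P]_w (\sum_(j <- r) h j w)%:E =
    \int[P]_w \sum_(j <- r) (EFin \o h j) w)%E.
  by apply: eq_integral => w _; rewrite /= sumEFin.
rewrite integral_sum//; last by move=> j; exact: (he j).1.
rewrite -sumEFin; apply: eq_bigr => j _; case: (he j) => _.
by rewrite unlock.
Qed.

Lemma measurable_draw i (A : set (V i)) : D i -> measurable (@Y i @^-1` A).
Proof.
move=> Di; have -> : @Y i @^-1` A = \bigcup_(a in A) (@Y i @^-1` [set a]).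
  apply/seteqP; split=> [w /= Aw|w [a Aa /= ->]//]; by exists (@Y i w).
apply: fin_bigcup_measurable => [|a _]; first exact: finite_finset.
by case: (pmfY Di a).
Qed.

(** The indicator makes the induction on [s2] possible: splitting on the value of the next draw
    moves its index from [s2] to [s1]. When [s2] is exhausted, [f] is constant and independence
    factors the probability of the intersection. *)
Lemma has_expectation_indic_draws (z0 : forall i, V i) s2 s1 f (A : forall i, set (V i)) :
  uniq (s1 ++ s2) -> (forall i, i \in s1 ++ s2 -> D i) -> depends_on s2 f ->
  has_expectation
    (fun w => \1_(\bigcap_(i in [set` s1]) (@Y i @^-1` A i)) w * f (Yz w))
    (\prod_(i <- s1) fine (P (@Y i @^-1` A i)) * prodE q s2 f z0).
Proof.
elim: s2 s1 f A => [|i s2 IH] s1 f A us Ds fs.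
  rewrite cats0 in us Ds.
  have mB : measurable (\bigcap_(i in [set` s1]) (@Y i @^-1` A i)).
    by apply: fin_bigcap_measurable => // i si; apply: measurable_draw; exact: Ds.
  have -> : (fun w => \1_(\bigcap_(i in [set` s1]) (@Y i @^-1` A i)) w * f (Yz w)) =
      (fun w => f z0 * \1_(\bigcap_(i in [set` s1]) (@Y i @^-1` A i)) w).
    by apply/funext => w; rewrite mulrC (fs _ z0).
  have iB := integrable_indic P mB.
  split.
    rewrite (_ : EFin \o _ = fun w => ((f z0)%:E *
        (\1_(\bigcap_(i in [set` s1]) (@Y i @^-1` A i)) w)%:E)%E).
      exact: integrableZl.
    by apply/funext => w /=; rewrite EFinM.
  rewrite unlock.
  under eq_integral do rewrite EFinM.
  rewrite integralZl// integral_indic// setIT /= mulrC EFinM; congr (_ * _)%E.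
  by rewrite -(indepY A us Ds) fineK// fin_num_measure.
have inotin : i \notin s1.
  by move: us; rewrite cat_uniq /= negb_or => /and3P[_ /andP[]].
have us' : uniq ((i :: s1) ++ s2).
  by rewrite -(perm_uniq (permEl (perm_catCA s1 [:: i] s2))).
have Ds' j : j \in (i :: s1) ++ s2 -> D j.
  by move=> js; apply: Ds; rewrite (perm_mem (permEl (perm_catCA s1 [:: i] s2))).
have Di : D i by apply: Ds'; rewrite mem_head.
pose A' a : forall j, set (V j) := @eqtype.dfwith I (fun j => set (V j)) A i [set a].
have capE a : \bigcap_(j in [set` i :: s1]) (@Y j @^-1` A' a j) =
    (@Y i @^-1` [set a]) `&` \bigcap_(j in [set` s1]) (@Y j @^-1` A j).
  have -> : [set` i :: s1] = i |` [set` s1].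
    apply/seteqP; split=> j /=; rewrite inE; first by move/predU1P.
    by move=> [->|->]; rewrite ?eqxx ?orbT.
  rewrite bigcap_setU1 /A' dfwith_in; congr (_ `&` _).
  apply: eq_bigcapr => j js; rewrite dfwith_out//.
  by apply: contraNneq inotin => ->.
have fdep (a : V i) : depends_on s2 (fun z => f (upd z a)).
  move=> z z' zz'; apply: fs => j; rewrite inE.
  have [<-|ij] := eqVneq i j; first by rewrite !dfwith_in.
  by move=> js;rewrite !dfwith_out//; exact: zz'.
have := @has_expectation_sum _ (index_enum (V i)) _ _
  (fun a => IH (i :: s1) _ (A' a) us' Ds' (fdep a)).
have -> : (fun w => \sum_(a : V i)
      \1_(\bigcap_(j in [set` i :: s1]) (@Y j @^-1` A' a j)) w * f (upd (Yz w) a)) =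
    (fun w => \1_(\bigcap_(i in [set` s1]) (@Y i @^-1` A i)) w * f (Yz w)).
  (* Only the value [a = Y i w] contributes, and substituting it changes nothing in the family of
     draws at [w]. *)
  apply/funext => w; rewrite (bigD1 (Y i w))//= big1 ?addr0 => [|a /eqP aY].
    rewrite capE indicI/= [X in X * _ * _]indicE mem_set// mul1r; congr (_ * f _).
    apply: functional_extensionality_dep => j; rewrite /Yz.
    by have [<-|ij] := eqVneq i j; rewrite ?dfwith_in ?dfwith_out.
  rewrite capE indicI/= [X in X * _ * _]indicE memNset ?mul0r//= => Ya.
  by apply: aY; rewrite Ya.
congr (has_expectation _ _); rewrite /= /avg mulr_sumr; apply: eq_bigr => a _.
rewrite prodE_upd ?big_cons; last first.
  by move: us; rewrite cat_uniq => /and3P[_ _ /=/andP[]].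
rewrite /A' dfwith_in mulrCA mulrA (pmfY Di a).2/=; congr (_ * _ * _).
rewrite big_seq [RHS]big_seq; apply: eq_bigr => j js.
by rewrite dfwith_out//; apply: contraNneq inotin => ->.
Qed.

Lemma expectation_draws (z0 : forall i, V i) s f :
  uniq s -> (forall i, i \in s -> D i) -> depends_on s f ->
  'E_P[fun w => f (fun i => Y i w)]%E = (prodE q s f z0)%:E.
Proof.
move=> us Ds fs.
have [_] := has_expectation_indic_draws z0 (s1 := [::]) (fun=> setT) us Ds fs.
rewrite big_nil mul1r => <-; congr ('E_P[_])%E; apply/funext => w.
by rewrite set_nil bigcap_set0 indicT mul1r.
Qed.

End ExpectationOfDraws.

(** * Orthogonality of centered terms *)

Section CenteredSum.
Context {R : realType} {I : eqType} {V : I -> finType} {d : nat}.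
Variable q : forall i, V i -> R.
Hypothesis q_ge0 : forall i (a : V i), 0 <= q a.
Hypothesis q_sum1 : forall i, \sum_(a : V i) q a = 1.

(** Conditional mean zero, stated by testing against vectors free of [i], so that only scalar
    functions are averaged. *)
Definition centered i (h : (forall i, V i) -> 'rV[R]_d) :=
  forall a : (forall i, V i) -> 'rV[R]_d, free_of i a ->
  avg q i (fun z => dotv (a z) (h z)) = fun=> 0.

Lemma prodE_centered s z0 i h a : i \in s -> centered i h -> free_of i a ->
  prodE q s (fun z => dotv (a z) (h z)) z0 = 0.
Proof. by move=> si ci ai; rewrite -(prodE_avg q_sum1 _ si) ci// prodE_cst. Qed.

(** Pythagoras in expectation: in every cross term one factor is centered at its own draw and the
    other factor is free of that draw. *)
Lemma prodE_sqnorm_centered_sum s z0 m (idx : 'I_m -> I) (c : 'I_m -> R)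
    (a : (forall i, V i) -> 'rV[R]_d) (h : 'I_m -> (forall i, V i) -> 'rV[R]_d) :
  (forall k, idx k \in s) -> (forall k, centered (idx k) (h k)) ->
  (forall k, free_of (idx k) a) ->
  (forall k k', k != k' -> free_of (idx k) (h k')) ->
  prodE q s (fun z => sqnorm (a z + \sum_(k < m) c k *: h k z)) z0 =
  prodE q s (fun z => sqnorm (a z)) z0 +
  \sum_(k < m) c k ^+ 2 * prodE q s (fun z => sqnorm (h k z)) z0.
Proof.
move=> ids ch fa fh.
have -> : (fun z => sqnorm (a z + \sum_(k < m) c k *: h k z)) =
    (fun z => sqnorm (a z) + (\sum_(k < m) (2 * c k) * dotv (a z) (h k z) +
       \sum_(k < m) \sum_(k' < m) (c k * c k') * dotv (h k z) (h k' z))).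
  apply/funext => z; rewrite !dotvDl !dotvDr (dotvC (\sum_(k < m) _) (a z)) -addrA.
  congr (_ + _); rewrite addrA; congr (_ + _).
    rewrite dotv_sumr -big_split; apply: eq_bigr => k _ /=.
    by rewrite dotvZr; ring.
  rewrite dotv_suml; apply: eq_bigr => k _; rewrite dotv_sumr.
  by apply: eq_bigr => k' _; rewrite dotvZl dotvZr mulrA.
rewrite !prodED !prodE_sum; congr (_ + _).
rewrite big1 ?add0r => [|k _]; last first.
  by rewrite prodEZ (prodE_centered _ (ids k)) ?mulr0.
apply: eq_bigr => k _; rewrite prodE_sum (bigD1 k)//= big1 ?addr0 => [|k' kk'].
  by rewrite prodEZ expr2.
by rewrite prodEZ (prodE_centered _ (ids k')) ?mulr0//; exact: fh.
Qed.

End CenteredSum.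

(** * Gradient of a local objective *)

Section LocalGradient.
Context {R : realType} {d N : nat} {X : Type} {n : 'I_N -> nat}.
Variables (ell : 'rV[R]_d -> X -> R) (x : forall k, 'I_(n k) -> X).
Hypothesis ell_diff : forall (z : X) (w : 'rV[R]_d), differentiable (ell ^~ z) w.

(** This makes a uniformly drawn sample gradient unbiased; differentiability of [ell] supplies the
    directional derivatives that are summed. *)
Lemma grad_local_objective k w : grad (local_objective ell x k) w =
  (n k)%:R^-1 *: \sum_(j < n k) stoch_grad ell w (x j).
Proof.
apply/rowP => i; rewrite !mxE summxE.
have -> : local_objective ell x k =
    (n k)%:R^-1 \*: \sum_(j < n k) (ell ^~ (x j)).
  by apply/funext => v; rewrite /local_objective /= fct_sumE.
have D j : derivable (ell ^~ (x j)) w (delta_mx 0 i) by exact: diff_derivable.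
rewrite deriveZ ?derive_sum//; last exact: derivable_sum.
by congr (_ * _); apply: eq_bigr => j _; rewrite mxE.
Qed.

End LocalGradient.

(** * FedAvg iterates as functions of the draws *)

Section FedAvgRecursion.
Context {R : realType} {d N : nat} {X : Type} {n : 'I_N -> nat}.
Variables (ell : 'rV[R]_d -> X -> R) (x : forall k, 'I_(n k) -> X).
Variables (p : 'I_N -> R) (K E T : nat) (eta : nat -> R) (w0 : 'rV[R]_d).
Hypothesis n_gt0 : forall k, (0 < n k)%N.
Hypothesis ell_diff : forall (z : X) (w : 'rV[R]_d), differentiable (ell ^~ z) w.
Hypothesis p_ge0 : forall k, 0 <= p k.
Hypothesis p_sum1 : \sum_(k < N) p k = 1.
Hypothesis K_gt0 : (0 < K)%N.
Hypothesis E_gt0 : (0 < E)%N.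

Local Notation draws := (forall i : @draw_index N K, @draw_type N n K i).
Local Notation data t k := (inl (t, k) : @draw_index N K).
Local Notation device t l := (inr (t, l) : @draw_index N K).
Local Notation Fk := (local_objective ell x).

(* No iterate uses a device draw at a time without synchronization, so the value
   [p] assigned there is immaterial. *)
Definition draw_pmf (i : @draw_index N K) : @draw_type N n K i -> R :=
  match i with inl u => fun=> (n u.2)%:R^-1 | inr _ => p end.

(** A finite list containing every draw that determines the iterates up to time [T] and the sampled
    gradients before [T]. *)
Definition draws_upto : seq (@draw_index N K) :=
  [seq data t k | t <- iota 0 T, k <- enum 'I_N] ++
  [seq device t l | t <- [seq t <- iota 1 T | sync_time E t], l <- enum 'I_K].

Definition iterate t k (z : draws) : 'rV[R]_d :=
  fedavg ell x E eta w0 (fun t k => z (data t k)) (fun t l => z (device t l)) t k.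

Definition sampled_grad t k (z : draws) : 'rV[R]_d :=
  stoch_grad ell (iterate t k z) (x (z (data t k))).

Definition local_step t k (z : draws) : 'rV[R]_d :=
  iterate t k z - eta t *: sampled_grad t k z.

Definition mean_iterate t z := \sum_(k < N) p k *: iterate t k z.

Definition mean_step t z := \sum_(k < N) p k *: local_step t k z.

Lemma iterateS t k z : iterate t.+1 k z =
  if sync_time E t.+1
  then K%:R^-1 *: \sum_(l < K) local_step t (z (device t.+1 l)) z
  else local_step t k z.
Proof. by []. Qed.

Lemma draw_pmf_ge0 i (a : @draw_type N n K i) : 0 <= draw_pmf a.
Proof. by case: i a => //= u a; rewrite invr_ge0. Qed.

Lemma draw_pmf_sum1 i : \sum_(a : @draw_type N n K i) draw_pmf a = 1.
Proof.
case: i => [u|u] //=; rewrite sumr_const card_ord -(mulr_natl _^-1) divff//.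
by rewrite pnatr_eq0 -lt0n.
Qed.

Lemma draws_upto_uniq : uniq draws_upto.
Proof.
rewrite cat_uniq; apply/and3P; split.
- by apply: allpairs_uniq; rewrite ?iota_uniq ?enum_uniq// => -[? ?] [? ?] _ _ [-> ->].
- apply/hasPn => _ /allpairsP[u [_ _ ->]]; apply/negP => /allpairsP[v [_ _]].
  by [].
- apply: allpairs_uniq; rewrite ?enum_uniq ?filter_uniq ?iota_uniq//.
  by move=> [? ?] [? ?] _ _ [-> ->].
Qed.

Lemma mem_data t k : (data t k \in draws_upto) = (t < T)%N.
Proof.
rewrite mem_cat orbC; apply/orP/idP => [[|]/allpairsP[u []]|tT].
- by [].
- by rewrite mem_iota add0n => /= tT _ [-> _].
- by right; apply/allpairsP; exists (t, k); rewrite mem_iota mem_enum.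
Qed.

Lemma mem_device t l : (device t l \in draws_upto) = (t <= T)%N && sync_time E t.
Proof.
rewrite mem_cat; apply/orP/andP => [[|]/allpairsP[u []]|[tT ts]].
- by [].
- by rewrite mem_filter mem_iota => /and3P[us _ uT] _ [-> _]; split.
- right; apply/allpairsP; exists (t, l); rewrite mem_filter mem_iota mem_enum ts.
  by case/andP: ts => ->.
Qed.

Lemma draws_upto_performed i : i \in draws_upto -> @performed_draws N K E i.
Proof. by case: i => [[t k]|[t l]]//; rewrite mem_device => /andP[]. Qed.

(** The substitute for adaptedness. Data draws count strictly before [t], so those of step [t] are
    fresh; device draws count up to [t], since the averaging at time [t] already uses them. *)
Lemma iterate_local t k (z z' : draws) :
  (forall s i, (s < t)%N -> z (data s i) = z' (data s i)) ->
  (forall s l, (s <= t)%N -> sync_time E s -> z (device s l) = z' (device s l)) ->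
  iterate t k z = iterate t k z'.
Proof.
elim: t k => [//|t IH] k zd zS; rewrite !iterateS.
have it i : iterate t i z = iterate t i z'.
  by apply: IH => [s j st|s l st]; [apply: zd; exact: leqW|apply: zS; exact: leqW].
have st i : local_step t i z = local_step t i z'.
  by rewrite /local_step /sampled_grad it zd.
case: ifP => [sy|_]; last exact: st.
by congr (_ *: _); apply: eq_bigr => l _; rewrite zS// st.
Qed.

Lemma iterate_depends t k : (t <= T)%N -> depends_on draws_upto (iterate t k).
Proof.
move=> tT z z' zz'; apply: iterate_local => [s i st|s l st ss]; apply: zz'.
  by rewrite mem_data (leq_trans st).
by rewrite mem_device ss (leq_trans st).
Qed.

Lemma sampled_grad_depends t k : (t < T)%N -> depends_on draws_upto (sampled_grad t k).
Proof.
move=> tT z z' zz'; rewrite /sampled_grad (iterate_depends k (ltnW tT) zz').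
by rewrite zz'// mem_data.
Qed.

Lemma iterate_free_data t k k' : free_of (data t k') (iterate t k).
Proof.
move=> z a; apply: iterate_local => [s i st|s l st ss]; rewrite dfwith_out//.
by apply: contraTneq st => -[->]; rewrite ltnn.
Qed.

Lemma sampled_grad_free_data t k k' : k' != k -> free_of (data t k') (sampled_grad t k).
Proof.
move=> kk' z a; rewrite /sampled_grad iterate_free_data dfwith_out//.
by apply: contraNneq kk' => -[->].
Qed.

Lemma local_step_free_device t k l : free_of (device t.+1 l) (local_step t k).
Proof.
move=> z a; have it : iterate t k (upd z a) = iterate t k z.
  apply: iterate_local => [s i st|s i st ss]; rewrite dfwith_out//.
  by apply: contraTneq st => -[<- _]; rewrite ltnn.
by rewrite /local_step /sampled_grad it dfwith_out.
Qed.

Lemma mean_iterate_free_data t k : free_of (data t k) (mean_iterate t).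
Proof. by move=> z a; apply: eq_bigr => i _; rewrite iterate_free_data. Qed.

Lemma mean_step_free_device t l : free_of (device t.+1 l) (mean_step t).
Proof. by move=> z a; apply: eq_bigr => i _; rewrite local_step_free_device. Qed.

(** * Centered gradient noises and sampling deviations *)

Definition noise t k z := grad (Fk k) (iterate t k z) - sampled_grad t k z.

(** The iterate is free of the data draw of its own step, so averaging over this draw turns the
    sampled gradient into the exact one. *)
Lemma noise_centered t k : centered draw_pmf (data t k) (noise t k).
Proof.
move=> a fa; apply/funext => z; rewrite /avg /=.
under eq_bigr => j _.
  rewrite fa /noise /sampled_grad iterate_free_data dfwith_in -dotvZr.
  over.
rewrite -dotv_sumr -scaler_sumr sumrB grad_local_objective// sumr_const card_ord.
rewrite -[X in X - _]scaler_nat scalerA mulfV ?pnatr_eq0 -?lt0n// scale1r subrr.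
by rewrite scaler0 dotvC dotv0l.
Qed.

Lemma noise_free_data t k k' : k' != k -> free_of (data t k') (noise t k).
Proof. by move=> kk' z a; rewrite /noise iterate_free_data sampled_grad_free_data. Qed.

Definition deviation t l (z : draws) := local_step t (z (device t.+1 l)) z - mean_step t z.

Lemma avg_device t l (f : 'I_N -> draws -> R) :
  (forall k, free_of (device t l) (f k)) ->
  avg draw_pmf (device t l) (fun z : draws => f (z (device t l)) z) =
  fun z : draws => \sum_(k < N) p k * f k z.
Proof.
move=> ff; apply/funext => z; apply: eq_bigr => k _.
by rewrite ff dfwith_in.
Qed.

(** Unbiasedness of Scheme I: a device drawn with probabilities [p] has the [p]-weighted mean as its
    expected local step. *)
Lemma deviation_centered t l : centered draw_pmf (device t.+1 l) (deviation t l).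
Proof.
move=> a fa; pose f k z := dotv (a z) (local_step t k z - mean_step t z).
rewrite (@avg_device _ _ f) => [|k z b]; last first.
  by rewrite /f fa local_step_free_device mean_step_free_device.
apply/funext => z; rewrite /f; under eq_bigr do rewrite -dotvZr scalerBr.
rewrite -dotv_sumr sumrB -scaler_suml p_sum1 scale1r subrr.
by rewrite dotvC dotv0l.
Qed.

Lemma avg_sqnorm_deviation t l :
  avg draw_pmf (device t.+1 l) (fun z => sqnorm (deviation t l z)) =
  fun z => \sum_(k < N) p k * sqnorm (local_step t k z - mean_step t z).
Proof.
apply: (@avg_device _ _ (fun k z => sqnorm (local_step t k z - mean_step t z))).
by move=> k z a; rewrite local_step_free_device mean_step_free_device.
Qed.

Lemma deviation_free_device t l l' : l' != l -> free_of (device t.+1 l') (deviation t l).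
Proof.
move=> ll' z a; rewrite /deviation local_step_free_device mean_step_free_device.
by rewrite dfwith_out//; apply: contraNneq ll' => -[->].
Qed.

(** * Structure of a communication round *)

Lemma iterate_sync t k k' z : (E %| t)%N -> iterate t k z = iterate t k' z.
(* Time 0 is not a synchronization time, but there all devices hold [w0]. *)
Proof. by case: t => [//|t Et]; rewrite !iterateS !ifT//. Qed.

Lemma iterate_round r m k z : (m < E)%N ->
  iterate (E * r + m) k z = iterate (E * r) k z -
    \sum_(i < m) eta (E * r + i) *: sampled_grad (E * r + i) k z.
Proof.
elim: m => [|m IH] mE; first by rewrite big_ord0 subr0 addn0.
(* No averaging occurs inside the round: [E] divides [E * r + m.+1] only if it divides [m.+1], which
   lies strictly between 0 and [E]. *)
rewrite addnS iterateS /sync_time -addnS dvdn_addr ?dvdn_mulr//.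
rewrite andbC gtnNdvd//= /local_step IH 1?ltnW//.
by rewrite big_ord_recr/= opprD addrA.
Qed.

(** A local step accumulates up to [E] gradients, an iterate within the round at most [E - 1]; hence
    E^2 in the sampling constant and (E - 1)^2 in the drift. *)
Lemma local_step_round r m k z : (m < E)%N ->
  local_step (E * r + m) k z = iterate (E * r) k z -
    \sum_(i < m.+1) eta (E * r + i) *: sampled_grad (E * r + i) k z.
Proof. by move=> mE; rewrite /local_step iterate_round// big_ord_recr/= opprD addrA. Qed.

(** * The one-step recursion in expectation *)

Variables (L mu G : R) (sigma : 'I_N -> R) (wstar : 'rV[R]_d) (Fkstar : 'I_N -> R).
Variable z0 : draws.
Hypothesis L_gt0 : 0 < L.
Hypothesis mu_ge0 : 0 <= mu.
Hypothesis Fk_smooth : forall k, smooth_fun L (Fk k).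
Hypothesis Fk_convex : forall k, strongly_convex_fun mu (Fk k).
Hypothesis Fkstar_le : forall k w, Fkstar k <= Fk k w.
Hypothesis wstar_min : is_minimizer (global_objective ell x p) wstar.
Hypothesis eta_gt0 : forall t, 0 < eta t.
Hypothesis eta_small : forall t, 4 * (eta t * L) <= 1.
Hypothesis eta_antimono : forall s t, (s <= t)%N -> eta t <= eta s.
Hypothesis eta_double : forall s t, (s <= t < s + E)%N -> eta s <= 2 * eta t.

Local Notation EX f := (prodE draw_pmf draws_upto f z0).
Local Notation Gamma :=
  (global_objective ell x p wstar - \sum_(k < N) p k * Fkstar k).
Local Notation Delta t := (EX (fun z => sqnorm (mean_iterate t z - wstar))).

Hypothesis noise_bound : forall t k, (t < T)%N ->
  EX (fun z => sqnorm (noise t k z)) <= sigma k ^+ 2.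
Hypothesis grad_bound : forall t k, (t < T)%N ->
  EX (fun z => sqnorm (sampled_grad t k z)) <= G ^+ 2.

Let EX_le f g : (forall z, f z <= g z) -> EX f <= EX g.
Proof. by move=> fg; apply: prodE_le => //; exact: draw_pmf_ge0. Qed.

Let EX_cst c : EX (fun=> c) = c.
Proof. by rewrite (prodE_cst draw_pmf_sum1). Qed.

Let EX_ge0 f : (forall z, 0 <= f z) -> 0 <= EX f.
Proof. by move=> f0; rewrite -[leLHS]EX_cst; exact: EX_le. Qed.

(** The mean step is the mean exact step [a] plus the noises with coefficients [eta t * p k]. These
    are centered at distinct data draws, so they only add variances, and [a] is bounded pathwise by
    [mean_descent]. *)
Lemma mean_step_descent t : (t < T)%N ->
  EX (fun z => sqnorm (mean_step t z - wstar)) <=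
  (1 - mu * eta t) * Delta t
  + 2 * EX (fun z => \sum_(k < N) p k * sqnorm (iterate t k z - mean_iterate t z))
  + eta t ^+ 2 * (6 * L * Gamma + \sum_(k < N) p k ^+ 2 * sigma k ^+ 2).
Proof.
move=> tT; pose a z := mean_iterate t z - wstar -
  eta t *: \sum_(k < N) p k *: grad (Fk k) (iterate t k z).
have -> : (fun z => sqnorm (mean_step t z - wstar)) =
    (fun z => sqnorm (a z + \sum_(k < N) (eta t * p k) *: noise t k z)).
  apply/funext => z; suff -> : mean_step t z - wstar =
      a z + \sum_(k < N) (eta t * p k) *: noise t k z by [].
  rewrite /a scaler_sumr -addrA -sumrN -big_split/= /mean_step /mean_iterate.
  rewrite [RHS]addrAC; congr (_ - _); rewrite -big_split/=.
  apply: eq_bigr => k _; rewrite /local_step /noise !scalerA !scalerBr scalerA.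
  by rewrite addKr (mulrC (p k)).
rewrite (@prodE_sqnorm_centered_sum _ _ _ _ _ draw_pmf_sum1 _ _ _ (fun k => data t k));
  first last.
- by move=> k k' kk'; exact: noise_free_data.
- move=> k z b; rewrite /a mean_iterate_free_data.
  by congr (_ - _ *: _); apply: eq_bigr => i _; rewrite iterate_free_data.
- by move=> k; exact: noise_centered.
- by move=> k; rewrite mem_data.
rewrite mulrDr addrA; apply: lerD.
  apply: (@le_trans _ _ (EX (fun z => (1 - mu * eta t) * sqnorm (mean_iterate t z - wstar)
    + 2 * (\sum_(k < N) p k * sqnorm (iterate t k z - mean_iterate t z))
    + eta t ^+ 2 * (6 * L * Gamma)))).
    by apply: EX_le => z; exact: mean_descent.
  by rewrite !prodED !prodEZ (prodE_cst draw_pmf_sum1).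
rewrite mulr_sumr; apply: ler_sum => k _; rewrite exprMn -mulrA.
by rewrite !ler_wpM2l ?sqr_ge0//; exact: noise_bound.
Qed.

Lemma round_sum_le r m k : (m <= E)%N -> (E * r + m <= T)%N ->
  EX (fun z => sqnorm (\sum_(i < m) eta (E * r + i) *: sampled_grad (E * r + i) k z))
  <= (m%:R * eta (E * r) * G) ^+ 2.
Proof.
move=> mE mT; apply: le_trans (EX_le (fun z => sqnorm_sum_le _)) _.
rewrite prodEZ prodE_sum.
have -> : (m%:R * eta (E * r) * G) ^+ 2 =
    m%:R * \sum_(i < m) eta (E * r) ^+ 2 * G ^+ 2.
  by rewrite sumr_const card_ord -mulr_natl; ring.
rewrite ler_wpM2l//; apply: ler_sum => i _.
under eq_fun do rewrite dotvZl dotvZr mulrA -expr2.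
rewrite prodEZ; apply: ler_pM; rewrite ?sqr_ge0//.
- by apply: EX_ge0 => z; exact: sqnorm_ge0.
- by rewrite ler_sqr ?nnegrE ?(ltW (eta_gt0 _))//; apply: eta_antimono; rewrite leq_addr.
- by apply: grad_bound; rewrite (leq_trans _ mT)// -addnS leq_add2l.
Qed.

(* The spread of a family around its mean is at most its spread around any
   common point; here around the common iterate at the start of the round. *)
Lemma round_spread_le (u : 'I_N -> draws -> 'rV[R]_d) r m t :
  (m <= E)%N -> (E * r + m <= T)%N -> (E * r <= t < E * r + E)%N ->
  (forall k z, u k z = iterate (E * r) k z -
    \sum_(i < m) eta (E * r + i) *: sampled_grad (E * r + i) k z) ->
  EX (fun z => \sum_(k < N) p k * sqnorm (u k z - \sum_(k < N) p k *: u k z))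
  <= 4 * eta t ^+ 2 * (m%:R ^+ 2 * G ^+ 2).
Proof.
move=> mE mT tr uE.
(* Weights summing to 1 force some device [k0] to exist; its iterate at the start of the round
   serves as the common point. *)
have [k0 _|N0] := pickP (fun _ : 'I_N => true); last first.
  by move: p_sum1; rewrite big_pred0// => /esym/eqP; rewrite oner_eq0.
apply: (@le_trans _ _ (EX (fun z => \sum_(k < N) p k *
    sqnorm (\sum_(i < m) eta (E * r + i) *: sampled_grad (E * r + i) k z)))).
  apply: EX_le => z.
  apply: le_trans (sqnorm_sub_mean_le (u^~ z) (iterate (E * r) k0 z) p_ge0 p_sum1) _.
  apply: ler_sum => k _; rewrite uE (@iterate_sync _ k k0) ?dvdn_mulr//.
  by rewrite addrAC subrr add0r sqnormN.
rewrite prodE_sum [leRHS](_ : _ = \sum_(k < N) p k *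
    (4 * eta t ^+ 2 * (m%:R ^+ 2 * G ^+ 2))); last by rewrite -mulr_suml p_sum1 mul1r.
apply: ler_sum => k _.
rewrite prodEZ ler_wpM2l//; apply: le_trans (round_sum_le _ mE mT) _.
rewrite (_ : (_ * _ * G) ^+ 2 = eta (E * r) ^+ 2 * (m%:R ^+ 2 * G ^+ 2)); last by ring.
apply: ler_wpM2r; first by rewrite mulr_ge0 ?sqr_ge0.
rewrite (_ : 4 = 2 ^+ 2); last by ring.
by rewrite -exprMn ler_sqr ?nnegrE ?mulr_ge0 ?(ltW (eta_gt0 _))//; exact: eta_double.
Qed.

(** The new common point is the mean step plus the average of [K] deviations centered at distinct
    device draws; [K] variances weighted by K^-2 give the factor 1/K. *)
Lemma sync_variance t : (t < T)%N -> sync_time E t.+1 ->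
  Delta t.+1 <= EX (fun z => sqnorm (mean_step t z - wstar)) +
  K%:R^-1 * EX (fun z => \sum_(k < N) p k * sqnorm (local_step t k z - mean_step t z)).
Proof.
move=> tT ts; pose a z := mean_step t z - wstar.
have K0 : K%:R != 0 :> R by rewrite pnatr_eq0 -lt0n.
have -> : (fun z => sqnorm (mean_iterate t.+1 z - wstar)) =
    (fun z => sqnorm (a z + \sum_(l < K) K%:R^-1 *: deviation t l z)).
  apply/funext => z; suff -> : mean_iterate t.+1 z - wstar =
      a z + \sum_(l < K) K%:R^-1 *: deviation t l z by [].
  rewrite /mean_iterate; under eq_bigr do rewrite iterateS ts.
  rewrite -scaler_suml p_sum1 scale1r /a /deviation -scaler_sumr.
  rewrite [in RHS]sumrB [in RHS]scalerBr.
  rewrite sumr_const card_ord -[X in _ - _ *: X]scaler_nat scalerA mulVf// scale1r.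
  by rewrite [RHS]addrC addrA subrK.
rewrite (@prodE_sqnorm_centered_sum _ _ _ _ _ draw_pmf_sum1 _ _ _ (fun l => device t.+1 l));
  first last.
- by move=> l l' ll'; exact: deviation_free_device.
- by move=> l z b; rewrite /a mean_step_free_device.
- by move=> l; exact: deviation_centered.
- by move=> l; rewrite mem_device ts tT.
rewrite lerD2l.
(* One more average over the device draw turns the squared deviation into the [p]-weighted spread of
   the local steps. *)
under eq_bigr => l _.
  rewrite -(prodE_avg draw_pmf_sum1 (i := device t.+1 l)) ?mem_device ?ts ?tT//.
  rewrite avg_sqnorm_deviation.
  over.
by rewrite sumr_const card_ord -[leLHS]mulr_natl mulrA expr2 mulrA mulfV// mul1r.
Qed.

(** This is B of the theorem, and [sampling_const] is C. *)
Definition drift_const : R :=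
  \sum_(k < N) p k ^+ 2 * sigma k ^+ 2 + 6 * L * Gamma
  + 8 * (E%:R - 1) ^+ 2 * G ^+ 2.

Definition sampling_const : R := 4 / K%:R * E%:R ^+ 2 * G ^+ 2.

Lemma fedavg_recursion t : (t < T)%N ->
  Delta t.+1 <= (1 - mu * eta t) * Delta t
  + eta t ^+ 2 * (drift_const + sampling_const).
Proof.
move=> tT; pose r := (t %/ E)%N; pose m := (t %% E)%N.
have tE : t = (E * r + m)%N by rewrite mulnC -divn_eq.
have mE : (m < E)%N by rewrite ltn_mod.
clearbody r m.
have tr : (E * r <= t < E * r + E)%N by rewrite tE leq_addr ltn_add2l.
have mean := mean_step_descent tT.
have eta40 : 0 <= 4 * eta t ^+ 2 by rewrite mulr_ge0// sqr_ge0.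
(* Here [m <= E - 1]; the factor 2 in [mean_step_descent] turns this 4 into the 8 of
   [drift_const]. *)
have spreadW : EX (fun z => \sum_(k < N) p k * sqnorm (iterate t k z - mean_iterate t z))
    <= 4 * eta t ^+ 2 * ((E%:R - 1) ^+ 2 * G ^+ 2).
  apply: (@le_trans _ _ (4 * eta t ^+ 2 * (m%:R ^+ 2 * G ^+ 2))).
    apply: (round_spread_le (ltnW mE) _ tr) => [|k z]; first by rewrite -tE ltnW.
    by rewrite [in LHS]tE iterate_round.
  rewrite ler_wpM2l// ler_wpM2r ?sqr_ge0//.
  have -> : E%:R - 1 = E.-1%:R :> R by rewrite -subn1 natrB.
  by rewrite ler_sqr ?nnegrE// ler_nat -ltnS prednK.
have spreadV : EX (fun z => \sum_(k < N) p k * sqnorm (local_step t k z - mean_step t z))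
    <= 4 * eta t ^+ 2 * (E%:R ^+ 2 * G ^+ 2).
  apply: (@le_trans _ _ (4 * eta t ^+ 2 * (m.+1%:R ^+ 2 * G ^+ 2))).
    apply: (round_spread_le mE _ tr) => [|k z]; first by rewrite addnS -tE.
    by rewrite [in LHS]tE local_step_round.
  rewrite ler_wpM2l// ler_wpM2r ?sqr_ge0//.
  by rewrite ler_sqr ?nnegrE// ler_nat.
have step : Delta t.+1 <= EX (fun z => sqnorm (mean_step t z - wstar)) +
    K%:R^-1 * (4 * eta t ^+ 2 * (E%:R ^+ 2 * G ^+ 2)).
  (* Without synchronization the next mean iterate is the mean step, and the sampling term is a
     nonnegative surplus. *)
  have [ts|/negbTE ts] := boolP (sync_time E t.+1).
    by apply: le_trans (sync_variance tT ts) _; rewrite lerD2l ler_wpM2l// invr_ge0.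
  rewrite (_ : mean_iterate t.+1 = mean_step t).
    by rewrite lerDl mulr_ge0 ?invr_ge0// mulr_ge0// mulr_ge0// sqr_ge0.
  by apply/funext => z; apply: eq_bigr => k _; rewrite iterateS ts.
rewrite /drift_const /sampling_const; lra.
Qed.

Lemma mean_objective_le :
  EX (fun z => global_objective ell x p (mean_iterate T z)) <=
  global_objective ell x p wstar + L / 2 * Delta T.
Proof.
apply: (@le_trans _ _ (EX (fun z => global_objective ell x p wstar +
    L / 2 * sqnorm (mean_iterate T z - wstar)))).
  by apply: EX_le => z; exact: mean_smooth_upper.
by rewrite prodED prodEZ EX_cst.
Qed.

End FedAvgRecursion.

(** * Solving the scalar recursion *)

Lemma recursion_rate (R : realFieldType) (mu gamma D : R) (Delta : nat -> R) (T : nat) :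
  0 < mu -> 2 <= gamma -> 0 <= D -> 0 <= Delta 1%N ->
  (forall t, (t < T)%N -> Delta t.+1 <=
    (1 - mu * (2 / (mu * (gamma + t%:R)))) * Delta t
    + (2 / (mu * (gamma + t%:R))) ^+ 2 * D) ->
  (1 <= T)%N ->
  Delta T <= (4 * D / mu ^+ 2 + gamma * Delta 1%N) / (gamma + T%:R - 1).
Proof.
move=> mu0 g2 D0 D1 rec T1; set v := 4 * D / mu ^+ 2 + gamma * Delta 1%N.
have e0 : 0 <= 4 * D / mu ^+ 2 by rewrite !mulr_ge0// invr_ge0 sqr_ge0.
(* The induction starts at time 1, where v >= gamma Delta_1 suffices; this shift is the -1 in the
   final denominator. *)
suff H t : (t < T)%N -> Delta t.+1 <= v / (gamma + t%:R).
  by case: T T1 {rec} H => // T _ H; rewrite -[T.+1%:R]natr1 addrA addrK; exact: H.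
elim: t => [|t IH] tT.
  rewrite addr0 ler_pdivlMr ?(lt_le_trans _ g2)// mulrC /v lerDr//.
apply: le_trans (rec _ tT) _; have {}IH := IH (ltnW tT).
rewrite (_ : gamma + t.+1%:R = gamma + t%:R + 1); last by rewrite -addrA natr1.
set s := gamma + t%:R; rewrite -/s in IH; have s2 : 2 <= s by rewrite /s ler_wpDr.
have s0 : 0 < s by lra.
have s10 : 0 < s + 1 by lra.
(* The contraction factor is nonnegative as [2 <= s], so the induction hypothesis may be multiplied
   by it. *)
have -> : 1 - mu * (2 / (mu * (s + 1))) = (s - 1) / (s + 1).
  by field; rewrite !gt_eqF.
have -> : (2 / (mu * (s + 1))) ^+ 2 * D = 4 * D / mu ^+ 2 / (s + 1) ^+ 2.
  by field; rewrite !gt_eqF.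
have ev : 4 * D / mu ^+ 2 <= v by rewrite lerDl mulr_ge0//; lra.
set e := 4 * D / mu ^+ 2 in ev e0 *.
apply: (@le_trans _ _ ((s - 1) / (s + 1) * (v / s) + v / (s + 1) ^+ 2)).
  apply: lerD; first by rewrite ler_wpM2l// divr_ge0//; lra.
  by rewrite ler_wpM2r// invr_ge0 sqr_ge0.
rewrite -subr_ge0.
have -> : v / (s + 1) - ((s - 1) / (s + 1) * (v / s) + v / (s + 1) ^+ 2) =
    v / (s * (s + 1) ^+ 2).
  by field; rewrite !gt_eqF.
by rewrite divr_ge0 ?(le_trans e0 ev)// mulr_ge0 ?sqr_ge0// ltW.
Qed.

(** * Step-size conditions and transfer to the probability space *)

Theorem theorem2 (R : realType)
  (disp : measure_display) (Omega : measurableType disp)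
  (P : probability Omega R)
  (d N : nat) (hd : (0 < d)%N)
  (p : 'I_N -> R) (hp0 : forall k, 0 <= p k) (hp1 : \sum_(k < N) p k = 1)
  (X : Type) (n : 'I_N -> nat) (hn : forall k, (0 < n k)%N)
  (x : forall k, 'I_(n k) -> X)
  (ell : 'rV[R]_d -> X -> R)
  (hell : forall (z : X) (w : 'rV[R]_d), differentiable (ell ^~ z) w)
  (K E T : nat) (hK1 : (1 <= K)%N) (hKN : (K <= N)%N)
  (hE : (1 <= E)%N) (hT : (1 <= T)%N) (hET : (E %| T)%N)
  (L mu G : R) (sigma : 'I_N -> R) (hmu : 0 < mu)
  (w0 wstar : 'rV[R]_d) (Fkstar : 'I_N -> R)
  (xi : nat -> forall k : 'I_N, Omega -> 'I_(n k))
  (S : nat -> 'I_K -> Omega -> 'I_N) :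
  let Fk : 'I_N -> 'rV[R]_d -> R := local_objective ell x in
  let F : 'rV[R]_d -> R := global_objective ell x p in
  let Fstar : R := F wstar in
  let Gamma : R := Fstar - \sum_(k < N) p k * Fkstar k in
  let kappa : R := L / mu in
  let gamma : R := Num.max (8 * kappa) E%:R in
  let eta : nat -> R := fun t => 2 / (mu * (gamma + t%:R)) in
  let wk : nat -> 'I_N -> Omega -> 'rV[R]_d := fun t k omega =>
    fedavg ell x E eta w0
      (fun t' k' => xi t' k' omega) (fun t' l => S t' l omega) t k in
  let w : nat -> Omega -> 'rV[R]_d := fun t omega =>
    \sum_(k < N) p k *: wk t k omega in
  let B : R := \sum_(k < N) p k ^+ 2 * sigma k ^+ 2 + 6 * L * Gamma
               + 8 * (E%:R - 1) ^+ 2 * G ^+ 2 in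
  let C : R := 4 / K%:R * E%:R ^+ 2 * G ^+ 2 in
  is_minimizer F wstar ->
  (forall k, is_min_value (Fk k) (Fkstar k)) ->
  (forall t k, has_pmf P (xi t k) (fun _ => (n k)%:R^-1)) ->
  (forall t l, sync_time E t -> has_pmf P (S t l) p) ->
  mutually_independent P (performed_draws E) (draw xi S) ->
  (forall k, smooth_fun L (Fk k)) ->
  (forall k, strongly_convex_fun mu (Fk k)) ->
  (forall t k, (t < T)%N ->
    ('E_P[fun omega =>
            (enorm (stoch_grad ell (wk t k omega) (x k (xi t k omega))
                    - grad (Fk k) (wk t k omega)) ^+ 2)%R]
     <= (sigma k ^+ 2)%:E)%E) ->
  (forall t k, (t < T)%N ->
    ('E_P[fun omega =>
            (enorm (stoch_grad ell (wk t k omega) (x k (xi t k omega))) ^+ 2)%R]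
     <= (G ^+ 2)%:E)%E) ->
  ('E_P[fun omega => F (w T omega)] - Fstar%:E
   <= (kappa / (gamma + T%:R - 1))%:E
      * ((2 * (B + C) / mu)%:E
         + (mu * gamma / 2)%:E
           * 'E_P[fun omega => (enorm (w 1%N omega - wstar) ^+ 2)%R]))%E.
Proof.
move=> Fk F Fstar Gamma kappa gamma eta wk w B C wmin hFk hxi hS hind hL hcvx hsig hG.
have [k0 _|N0] := pickP (fun _ : 'I_N => true); last first.
  by move: hp1; rewrite big_pred0// => /esym/eqP; rewrite oner_eq0.
(* This yields [0 < L] and [1 <= kappa], hence gamma >= 8. *)
have muL : mu <= L := smooth_strongly_convex_le hd (hL k0) (hcvx k0).
have L0 : 0 < L := lt_le_trans hmu muL.
have Fkstar_le k v : Fkstar k <= Fk k v by have [u umin <-] := hFk k; exact: umin.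
have gamma8 : 8 * kappa <= gamma by rewrite le_max lexx.
have gammaE : E%:R <= gamma by rewrite le_max lexx orbT.
have kappa1 : 1 <= kappa by rewrite ler_pdivlMr ?mul1r.
have gt0 t : 0 < gamma + t%:R by rewrite ltr_wpDr//; lra.
have mugt0 t : 0 < mu * (gamma + t%:R) by rewrite mulr_gt0.
have eta_gt0 t : 0 < eta t by rewrite divr_gt0.
(* From gamma >= 8 kappa: 4 eta_t L = 8 L / (mu (gamma + t)) <= 1. *)
have eta_small t : 4 * (eta t * L) <= 1.
  rewrite /eta mulrAC mulrA ler_pdivrMr// mul1r.
  have : 8 * L <= gamma * mu by rewrite -ler_pdivrMr// -mulrA.
  have : 0 <= mu * t%:R by rewrite mulr_ge0// ltW.
  by lra.
have eta_antimono s t : (s <= t)%N -> eta t <= eta s.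
  move=> st; rewrite ler_pM2l// lef_pV2 ?posrE// ler_pM2l// lerD2l.
  by rewrite ler_nat.
(* From gamma >= E: gamma + t <= gamma + s + E <= 2 (gamma + s). *)
have eta_double s t : (s <= t < s + E)%N -> eta s <= 2 * eta t.
  move=> /andP[_ tsE]; rewrite /eta mulrCA ler_pM2l// ler_pdivlMr// mulrC.
  rewrite ler_pdivrMr// mulrCA ler_pM2l//.
  have : (t%:R : R) <= s%:R + E%:R by rewrite -natrD ler_nat ltnW.
  have : 0 <= (s%:R : R) by [].
  by lra.
pose z0 (i : @draw_index N K) : @draw_type N n K i :=
  match i with inl u => Ordinal (hn u.2) | inr _ => k0 end.
have pmf i : performed_draws E i -> has_pmf P (draw xi S i) (@draw_pmf _ _ n p K i).
  by case: i => [[t k] _|[t l] st]; [exact: hxi|exact: hS].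
have EP f : depends_on (@draws_upto N K E T) f ->
    'E_P[fun omega => f (fun i => draw xi S i omega)]%E =
    (prodE (@draw_pmf _ _ n p K) (@draws_upto N K E T) f z0)%:E.
  move=> df; apply: (expectation_draws (V := @draw_type N n K) (D := performed_draws E)) => //.
  - exact: draws_upto_uniq.
  - by move=> i; exact: draws_upto_performed.
pose Delta t := prodE (@draw_pmf _ _ n p K) (@draws_upto N K E T) (fun z =>
  dotv (mean_iterate ell x p E eta w0 t z - wstar)
       (mean_iterate ell x p E eta w0 t z - wstar)) z0.
have mean_dep t : (t <= T)%N ->
    depends_on (@draws_upto N K E T) (mean_iterate ell x p E eta w0 (K := K) t).
  move=> tT z z' zz'; apply: eq_bigr => k _.
  by rewrite (iterate_depends _ _ _ _ _ tT zz').
have noise_bound t k : (t < T)%N -> prodE (@draw_pmf _ _ n p K) (@draws_upto N K E T)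
    (fun z => dotv (noise ell x E eta w0 t k z) (noise ell x E eta w0 t k z)) z0
    <= sigma k ^+ 2.
  move=> tT; rewrite -lee_fin -EP; last first.
    move=> z z' zz'; rewrite /noise (iterate_depends _ _ _ _ _ (ltnW tT) zz').
    by rewrite (sampled_grad_depends _ _ _ _ _ tT zz').
  apply: le_trans (hsig t k tT); rewrite le_eqVlt; apply/orP; left; apply/eqP.
  congr ('E_P[_])%E; apply/funext => omega.
  by rewrite enorm_sqr -sqnormN opprB.
have grad_bound t k : (t < T)%N -> prodE (@draw_pmf _ _ n p K) (@draws_upto N K E T)
    (fun z => dotv (sampled_grad ell x E eta w0 t k z) (sampled_grad ell x E eta w0 t k z)) z0
    <= G ^+ 2.
  move=> tT; rewrite -lee_fin -EP; last first.
    by move=> z z' zz'; rewrite (sampled_grad_depends _ _ _ _ _ tT zz').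
  apply: le_trans (hG t k tT); rewrite le_eqVlt; apply/orP; left; apply/eqP.
  congr ('E_P[_])%E; apply/funext => omega.
  by rewrite enorm_sqr.
have BC0 : 0 <= B + C.
  (* Each [Fkstar k] is at most the value of [Fk k] at [wstar]. *)
  have G0 : 0 <= Gamma.
    rewrite /Gamma /Fstar /F /global_objective -sumrB sumr_ge0// => k _.
    by rewrite -mulrBr mulr_ge0// subr_ge0; exact: Fkstar_le.
  have Kinv0 : 0 <= K%:R^-1 :> R by rewrite invr_ge0.
  by rewrite /B /C !addr_ge0 ?sumr_ge0// => *;
     do ?[exact: sqr_ge0 | exact: ltW | apply: mulr_ge0].
have rec t : (t < T)%N ->
    Delta t.+1 <= (1 - mu * eta t) * Delta t + eta t ^+ 2 * (B + C).
  exact: (fedavg_recursion hn hell hp0 hp1 hK1 hE L0 (ltW hmu) hL hcvx Fkstar_le wmin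
    eta_gt0 eta_small eta_antimono eta_double noise_bound grad_bound).
have Delta1 : 0 <= Delta 1%N.
  rewrite -lee_fin -EP; last by move=> z z' zz'; rewrite (mean_dep _ hT _ _ zz').
  by apply: expectation_ge0 => omega; exact: sqnorm_ge0.
have rate := recursion_rate hmu (ltac:(lra) : 2 <= gamma) BC0 Delta1 rec hT.
have gap := mean_objective_le (K := K) E T eta w0 hn hp0 hp1 z0 L0 hL wmin.
have -> : 'E_P[fun omega => F (w T omega)]%E =
    (prodE (@draw_pmf _ _ n p K) (@draws_upto N K E T)
       (fun z => F (mean_iterate ell x p E eta w0 T z)) z0)%:E.
  by rewrite -EP// => z z' zz'; rewrite (mean_dep _ (leqnn T) _ _ zz').
have -> : 'E_P[fun omega => (enorm (w 1%N omega - wstar) ^+ 2)%R]%E = (Delta 1%N)%:E.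
  rewrite -EP; last by move=> z z' zz'; rewrite (mean_dep _ hT _ _ zz').
  by congr ('E_P[_])%E; apply/funext => omega; rewrite enorm_sqr.
rewrite -EFinB -[leRHS]/((kappa / (gamma + T%:R - 1) *
  (2 * (B + C) / mu + mu * gamma / 2 * Delta 1%N))%:E) lee_fin lerBlDl.
apply: le_trans gap _; rewrite lerD2l.
(* Multiplying the rate by L/2 turns 4 (B + C) / mu^2 into kappa times 2 (B + C) / mu, and gamma
   into kappa times mu gamma / 2. *)
apply: le_trans (ler_wpM2l _ rate) _; first by rewrite divr_ge0 ?ltW.
rewrite le_eqVlt; apply/orP; left; apply/eqP.
have gT : 0 < gamma + T%:R - 1 by have : 0 <= (T%:R : R) by []; lra.
by rewrite /kappa; field; rewrite !gt_eqF.
Qed.
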